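(* Let $X$ be an Archimedean Riesz space with unit $e$ and let $N$ be a proper uniformly closed order ideal of $X$. If $V:X\to\mathbf{R}$ is normalized, monotone, unit-additive, unit-modular and $N$-invariant, then there exists a normalized capacity $\nu:\mathscr{B}(\mathcal{E}_N)\to\mathbf{R}$ such that $$\forall x\in X,\quad V(x)=\int_{\mathcal{E}_N}\langle x,\xi\rangle\,\mathrm{d}\nu(\xi).$$
   Context: A Riesz space is a real vector lattice; it is Archimedean if $0\le nx\le y$ for all $n\in\mathbf{N}$ implies $x=0$. A (strong order) unit is a nonzero $e$ such that every $x$ satisfies $-\lambda e\le x\le\lambda e$ for some $\lambda\ge0$. An order ideal is a solid vector subspace ($|x|\le|y|$, $y\in N$ imply $x\in N$). $N$ is uniformly closed if $x\in N$ whenever there are $x_n\in N$, $y>0$ and reals $\varepsilon_n\downarrow0$ with $|x_n-x|\le\varepsilon_n y$ for all $n$. $X$ carries the norm $\|x\|=\inf\{\lambda\ge0:|x|\le\lambda e\}$; $X^\star$ is its norm dual with the weak$^\star$ topology, $X^\star_+=\{\xi:\langle x,\xi\rangle\ge0\ \forall x\ge0\}$, $\Delta=\{\xi\in X^\star_+:\langle e,\xi\rangle=1\}$, $\Delta_N=\Delta\cap N^\perp$ (functionals in $\Delta$ vanishing on $N$), and $\mathcal{E}_N$ is the set of extreme points of $\Delta_N$, with relative weak$^\star$ topology and Borel $\sigma$-algebra $\mathscr{B}(\mathcal{E}_N)$. A functional $V:X\to\mathbf{R}$ is normalized if $V(\lambda e)=\lambda$ for all $\lambda\in\mathbf{R}$;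 monotone if $x\le y$ implies $V(x)\le V(y)$; unit-additive if $V(x+\lambda e)=V(x)+V(\lambda e)$ for all $x$ and $\lambda\ge0$; unit-modular if $V(x\vee\lambda e)+V(x\wedge\lambda e)=V(x)+V(\lambda e)$ for all $x$ and $\lambda\in\mathbf{R}$; $N$-invariant if $V(x)=V(y)$ whenever $x-y\in N$. A normalized capacity on a $\sigma$-algebra is a monotone set function with value $0$ at $\emptyset$ and $1$ at the whole space; the integral is the Choquet integral $\int f\,\mathrm{d}\nu=\int_0^\infty\nu(f\ge t)\,\mathrm{d}t+\int_{-\infty}^0[\nu(f\ge t)-1]\,\mathrm{d}t$. *)

(* Defs.v *)
From HB Require Import structures.
From mathcomp Require Import all_boot all_order all_algebra.
From mathcomp Require Import all_classical all_reals all_analysis.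
Set Implicit Arguments. Unset Strict Implicit. Unset Printing Implicit Defensive.
Import Order.TTheory GRing.Theory Num.Theory.
Local Open Scope classical_set_scope.
Local Open Scope ring_scope.

Definition riesz_space (R : realType) (X : lmodType R)
    (le : X -> X -> Prop) (join meet : X -> X -> X) : Prop :=
  (forall x, le x x) /\
  (forall x y z, le x y -> le y z -> le x z) /\
  (forall x y, le x y -> le y x -> x = y) /\
  (forall x y z, le x y -> le (x + z) (y + z)) /\
  (forall (a : R) x y, 0 <= a -> le x y -> le (a *: x) (a *: y)) /\
  (forall x y, le x (join x y) /\ le y (join x y) /\
     forall z, le x z -> le y z -> le (join x y) z) /\
  (forall x y, le (meet x y) x /\ le (meet x y) y /\
     forall z, le z x -> le z y -> le z (meet x y)).

Definition rabs (R : realType) (X : lmodType R) (join : X -> X -> X) (x : X) : X :=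
  join x (- x).

Definition archimedean (R : realType) (X : lmodType R) (le : X -> X -> Prop) : Prop :=
  forall x y : X, (forall n : nat, le 0 (x *+ n) /\ le (x *+ n) y) -> x = 0.

Definition strong_unit (R : realType) (X : lmodType R) (le : X -> X -> Prop) (e : X) : Prop :=
  e <> 0 /\ forall x : X, exists l : R, 0 <= l /\ le (- (l *: e)) x /\ le x (l *: e).

Definition order_ideal (R : realType) (X : lmodType R) (le : X -> X -> Prop)
    (join : X -> X -> X) (N : set X) : Prop :=
  N 0 /\ (forall x y, N x -> N y -> N (x + y)) /\
  (forall (a : R) x, N x -> N (a *: x)) /\
  (forall x y, le (rabs join x) (rabs join y) -> N y -> N x).

Definition uniformly_closed (R : realType) (X : lmodType R) (le : X -> X -> Prop)
    (join : X -> X -> X) (N : set X) : Prop :=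
  forall (x : X) (xs : nat -> X) (y : X) (eps : nat -> R),
    (forall n, N (xs n)) -> le 0 y -> y <> 0 ->
    (forall n, eps n.+1 <= eps n) -> eps n @[n --> \oo] --> 0%R ->
    (forall n, le (rabs join (xs n - x)) (eps n *: y)) -> N x.

Definition unit_norm (R : realType) (X : lmodType R) (le : X -> X -> Prop)
    (join : X -> X -> X) (e : X) (x : X) : R :=
  inf [set l : R | 0 <= l /\ le (rabs join x) (l *: e)].

Definition linear_functional (R : realType) (X : lmodType R) (xi : X -> R) : Prop :=
  forall (a : R) (x y : X), xi (a *: x + y) = a * xi x + xi y.

Definition norm_dual (R : realType) (X : lmodType R) (le : X -> X -> Prop)
    (join : X -> X -> X) (e : X) (xi : X -> R) : Prop :=
  linear_functional xi /\
  exists C : R, forall x, `|xi x| <= C * unit_norm le join e x.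

Definition positive_dual (R : realType) (X : lmodType R) (le : X -> X -> Prop)
    (join : X -> X -> X) (e : X) (xi : X -> R) : Prop :=
  norm_dual le join e xi /\ forall x, le 0 x -> 0 <= xi x.

Definition Delta_N (R : realType) (X : lmodType R) (le : X -> X -> Prop)
    (join : X -> X -> X) (e : X) (N : set X) : set (X -> R) :=
  [set xi | positive_dual le join e xi /\ xi e = 1 /\ forall x, N x -> xi x = 0].

Definition extreme_points (R : realType) (X : lmodType R) (K : set (X -> R)) : set (X -> R) :=
  [set xi | K xi /\ forall (eta zeta : X -> R) (l : R), K eta -> K zeta ->
     0 < l < 1 -> xi = (fun x => l * eta x + (1 - l) * zeta x) -> eta = zeta].

Definition ext_N (R : realType) (X : lmodType R) (le : X -> X -> Prop)
    (join : X -> X -> X) (e : X) (N : set X) : set (X -> R) :=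
  extreme_points (Delta_N le join e N).

Definition weakstar_open (R : realType) (X : lmodType R) (S : set (X -> R))
    (U : set (X -> R)) : Prop :=
  U `<=` S /\ forall xi, U xi -> exists (s : seq X) (r : R), 0 < r /\
    [set eta | S eta /\ forall x, x \in s -> `|eta x - xi x| < r] `<=` U.

Definition borel_sets (R : realType) (X : lmodType R) (S : set (X -> R)) : set (set (X -> R)) :=
  <<s S, weakstar_open S >>.

Definition normalized_capacity (R : realType) (X : lmodType R) (S : set (X -> R))
    (nu : set (X -> R) -> R) : Prop :=
  nu set0 = 0 /\ nu S = 1 /\
  forall A B, borel_sets S A -> borel_sets S B -> A `<=` B -> nu A <= nu B.

Definition choquet (R : realType) (X : lmodType R) (S : set (X -> R))
    (nu : set (X -> R) -> R) (f : (X -> R) -> R) : \bar R :=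
  (\int[@lebesgue_measure R]_(t in `[0%R, +oo[%classic)
      (nu [set xi | S xi /\ t <= f xi])%:E
   + \int[@lebesgue_measure R]_(t in `]-oo, 0%R[%classic)
      (nu [set xi | S xi /\ t <= f xi] - 1)%:E)%E.

Definition normalized_fun (R : realType) (X : lmodType R) (e : X) (V : X -> R) : Prop :=
  forall l : R, V (l *: e) = l.
Definition monotone_fun (R : realType) (X : lmodType R) (le : X -> X -> Prop) (V : X -> R) : Prop :=
  forall x y, le x y -> V x <= V y.
Definition unit_additive (R : realType) (X : lmodType R) (e : X) (V : X -> R) : Prop :=
  forall (x : X) (l : R), 0 <= l -> V (x + l *: e) = V x + V (l *: e).
Definition unit_modular (R : realType) (X : lmodType R) (join meet : X -> X -> X)
    (e : X) (V : X -> R) : Prop :=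
  forall (x : X) (l : R), V (join x (l *: e)) + V (meet x (l *: e)) = V x + V (l *: e).
Definition N_invariant (R : realType) (X : lmodType R) (N : set X) (V : X -> R) : Prop :=
  forall x y, N (x - y) -> V x = V y.

(* Main.v *)
(** The lattice homomorphisms [xi : X -> R] with [xi e = 1] vanishing on [N] are
    extreme points of [Delta_N], and they separate [X] modulo [N]: if [w >= 0] is
    not in [N] then, [N] being uniformly closed, [(w - eps e)^+] is not in [N]
    for some [eps > 0]; the ideal generated by [N] and [(eps e - w)^+] is then
    proper, a maximal ideal [P] above it has [X / P = R], and the quotient map
    takes a value at least [eps] at [w].  Hence [V] is monotone for the pointwise
    order on these characters.

    Put [F_x t = V (x /\ t e)].  Unit-modularity and unit-additivity say that
    [F_x b - F_x a] is the value of [V] at the slice [(x /\ b e) \/ a e - a e].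
    Comparing thin slices of [n x] with thin slices of [x] shows that [V] is
    homogeneous on positive elements.  Let [nu A] be the infimum of [V s] over the
    [s] with values in [0, 1] that are equal to 1 on [A].  Since a slice of height
    [h] is a multiple by [h] of an element with values in [0, 1],
    [h nu (x >= t + h) <= F_x (t + h) - F_x t <= h nu (x >= t)], and these bounds
    force [F_x] to be an antiderivative of [t |-> nu (x >= t)]. *)
Require Import Defs.
From HB Require Import structures.
From mathcomp Require Import all_boot all_order all_algebra.
From mathcomp Require Import all_classical all_reals all_analysis.
From mathcomp Require Import measurable_realfun ring lra.
Import Order.TTheory GRing.Theory Num.Theory.
Local Open Scope classical_set_scope.
Local Open Scope ring_scope.

(** * Integrals of nonincreasing functions *)

(** Telescoping; the slope [c] may have either sign. It serves for Riemann sums and again for sums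
    of slices. *)
Lemma ler_sum_increments {R : realType} (f g : nat -> R) (c : R) (K : nat) :
  (forall k, (k < K)%N -> f k.+1 - f k <= c * (g k.+1 - g k)) ->
  f K - f 0%N <= c * (g K - g 0%N).
Proof.
elim: K => [|K IH] H; first by rewrite !subrr mulr0.
have h1 := H K (ltnSn K).
have h2 := IH (fun k kK => H k (ltnW kK)).
lra.
Qed.

Lemma lebesgue_itvco {R : realType} (a b : R) : a <= b ->
  @lebesgue_measure R `[a, b[ = (b - a)%:E.
Proof.
rewrite le_eqVlt => /predU1P[->|ab].
  by rewrite set_itvco0 measure0 subrr.
by rewrite lebesgue_measure_itv /= lte_fin ab.
Qed.

Lemma integrable_nonincreasing_itvco {R : realType} (phi : R -> R) (a b : R) :
  {homo phi : s t / s <= t >-> t <= s} ->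
  (@lebesgue_measure R).-integrable `[a, b[ (EFin \o phi).
Proof.
move=> ni; apply: measurable_bounded_integrable => //.
- by rewrite /= lebesgue_measure_itv /=; case: ifP => _; rewrite -?EFinD ?ltry ?lt0y.
- exact: nonincreasing_measurable.
- exists (`|phi a| + `|phi b|); split; first exact: num_real.
  move=> M hM x /=; rewrite in_itv/= => /andP[ax xb].
  apply/ltW/(le_lt_trans _ hM).
  have h1 := ni _ _ ax; have h2 := ni _ _ (ltW xb).
  have := ler_norm (phi a); have := ler_norm (- phi b); rewrite normrN.
  move=> ? ?; have := normr_ge0 (phi a); have := normr_ge0 (phi b).
  by rewrite ler_norml; lra.
Qed.

Lemma Rintegral_nonincreasing_itvco_bounds {R : realType} (phi : R -> R) (a b : R) :
  {homo phi : s t / s <= t >-> t <= s} -> a <= b ->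
  (b - a) * phi b <= \int[@lebesgue_measure R]_(t in `[a, b[) phi t <= (b - a) * phi a.
Proof.
move=> ni ab.
have Icst (c : R) : \int[@lebesgue_measure R]_(t in `[a, b[) c = (b - a) * c.
  by rewrite Rintegral_cst//= lebesgue_itvco//= mulrC.
have icst (c : R) : (@lebesgue_measure R).-integrable `[a, b[ (EFin \o cst c).
  by apply: integrable_nonincreasing_itvco.
rewrite -!Icst; apply/andP; split; apply: le_Rintegral => //=.
- exact: integrable_nonincreasing_itvco.
- exact: integrable_nonincreasing_itvco.
- by move=> x; rewrite in_itv/= => /andP[ax xb]; apply/ni/ltW.
- exact: integrable_nonincreasing_itvco.
- exact: integrable_nonincreasing_itvco.
- by move=> x; rewrite in_itv/= => /andP[ax xb]; apply/ni.
Qed.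

Lemma Rintegral_itvco_cat {R : realType} (phi : R -> R) (a b c : R) :
  {homo phi : s t / s <= t >-> t <= s} -> a <= b -> b <= c ->
  \int[@lebesgue_measure R]_(t in `[a, c[) phi t =
  \int[@lebesgue_measure R]_(t in `[a, b[) phi t +
  \int[@lebesgue_measure R]_(t in `[b, c[) phi t.
Proof.
move=> ni ab bc.
rewrite (@itv_bndbnd_setU _ _ _ (BLeft b)) ?bnd_simp// Rintegral_setU//.
- rewrite -itv_bndbnd_setU ?bnd_simp//; exact: integrable_nonincreasing_itvco.
- apply/disj_setPS => y [/=]; rewrite 2!in_itv/= => /andP[_ yx] /andP[].
  by rewrite leNgt yx.
Qed.

(** Over a step [h = 1/(m+1)] the increments of [F] and of the integral both lie between
    [h * phi (t + h)] and [h * phi t]. The gaps telescope to [h * (phi a - phi (a + K))], which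
    tends to 0 with [h]. The integer length [K] makes every such mesh fit exactly. *)
Lemma integral_nonincreasing_increment {R : realType} (phi F : R -> R) (a : R) (K : nat) :
  {homo phi : s t / s <= t >-> t <= s} ->
  (forall (t : R) (m : nat),
     m.+1%:R^-1 * phi (t + m.+1%:R^-1) <= F (t + m.+1%:R^-1) - F t <= m.+1%:R^-1 * phi t) ->
  (\int[@lebesgue_measure R]_(t in `[a, (a + K%:R)%R[) (phi t)%:E = (F (a + K%:R) - F a)%:E)%E.
Proof.
move=> ni HF.
have iphi := integrable_nonincreasing_itvco phi a (a + K%:R) ni.
rewrite -(fineK (integrable_fin_num _ iphi))//; congr (_%:E).
pose I : R := \int[@lebesgue_measure R]_(t in `[a, a + K%:R[) phi t.
change (I = F (a + K%:R) - F a).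
pose G m k : R := \int[@lebesgue_measure R]_(t in `[a, a + k%:R * m.+1%:R^-1[) phi t.
suff cl m : `|I - (F (a + K%:R) - F a)| <= (phi a - phi (a + K%:R)) / m.+1%:R.
  apply/subr0_eq/eqP; rewrite -normr_le0 leNgt; apply/negP => I0.
  have p0 : 0 <= phi a - phi (a + K%:R) by rewrite subr_ge0 ni// lerDl.
  set C := phi a - _ in p0 cl; set z := `|_| in I0 cl.
  have := archi_boundP (divr_ge0 p0 (ltW I0)).
  set n := Num.Def.archi_bound _ => hn.
  have := cl n; rewrite ler_pdivlMr ?ltr0n//.
  move: hn; rewrite ltr_pdivrMr// => hn.
  rewrite leNgt => /negP; apply; apply: (lt_le_trans hn).
  by rewrite mulrC ler_wpM2l ?ler_nat// ltW.
set h : R := m.+1%:R^-1.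
have h0 : 0 < h by rewrite invr_gt0 ltr0n.
have hS k : a + k.+1%:R * h = a + k%:R * h + h by rewrite -natr1 mulrDl mul1r addrA.
have hle k : a <= a + k%:R * h by rewrite lerDl mulr_ge0// ltW.
have hK : a + (K * m.+1)%:R * h = a + K%:R by rewrite natrM mulfK ?pnatr_eq0.
have Gbound k : h * phi (a + k.+1%:R * h) <= G m k.+1 - G m k <= h * phi (a + k%:R * h).
  have lk : a + k%:R * h <= a + k.+1%:R * h by rewrite hS lerDl ltW.
  have -> : G m k.+1 - G m k = \int[@lebesgue_measure R]_(t in `[a + k%:R * h, a + k.+1%:R * h[) phi t.
    by rewrite /G (Rintegral_itvco_cat _ _ _ _ ni (hle k) lk) addrC addKr.
  have := Rintegral_nonincreasing_itvco_bounds phi _ _ ni lk.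
  by have -> : a + k.+1%:R * h - (a + k%:R * h) = h by rewrite hS addrC addKr.
have G0 : G m 0%N = 0 by rewrite /G mul0r addr0 set_itvco0 Rintegral_set0.
have GK : G m (K * m.+1)%N = I by rewrite /G -/h hK.
have FB k := HF (a + k%:R * h) m.
rewrite -/h in FB.
pose D k : R := G m k - F (a + k%:R * h).
pose p k : R := phi (a + k%:R * h).
have D1 : D (K * m.+1)%N - D 0%N <= (- h) * (p (K * m.+1)%N - p 0%N).
  apply: ler_sum_increments => k _.
  have /andP[? ?] := Gbound k; have /andP[] := FB k; rewrite -hS => ? ?.
  rewrite /D /p; lra.
have D2 : - D (K * m.+1)%N - - D 0%N <= (- h) * (p (K * m.+1)%N - p 0%N).
  apply: (ler_sum_increments (fun k => - D k)) => k _.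
  have /andP[? ?] := Gbound k; have /andP[] := FB k; rewrite -hS => ? ?.
  rewrite /D /p; lra.
move: D1 D2; rewrite /D /p hK GK G0 mul0r addr0.
rewrite ler_norml; lra.
Qed.

(** * Riesz spaces and order ideals *)

Section riesz_spaces.
Context {R : realType} {X : lmodType R}.
Variables (le : X -> X -> Prop) (join meet : X -> X -> X).
Hypothesis hX : riesz_space le join meet.
Local Notation "x <== y" := (le x y) (at level 70, no associativity).

Lemma rle_refl x : x <== x. Proof. by case: hX. Qed.
Hint Resolve rle_refl : core.

Lemma rle_trans {y x z} : x <== y -> y <== z -> x <== z.
Proof. by case: hX => _ [+ _]; exact. Qed.

Lemma rle_anti x y : x <== y -> y <== x -> x = y.
Proof. by case: hX => _ [_ [+ _]]; exact. Qed.

Lemma rle_addr z x y : x <== y -> x + z <== y + z.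
Proof. by case: hX => _ [_ [_ [+ _]]]; exact. Qed.

Lemma rle_scale (a : R) x y : 0 <= a -> x <== y -> a *: x <== a *: y.
Proof. by case: hX => _ [_ [_ [_ [+ _]]]]; exact. Qed.

Lemma join_ubl x y : x <== join x y.
Proof. by case: hX => _ [_ [_ [_ [_ [h _]]]]]; have [] := h x y. Qed.

Lemma join_ubr x y : y <== join x y.
Proof. by case: hX => _ [_ [_ [_ [_ [h _]]]]]; have [_ []] := h x y. Qed.

Lemma join_lub x y z : x <== z -> y <== z -> join x y <== z.
Proof. by case: hX => _ [_ [_ [_ [_ [h _]]]]]; have [_ [_]] := h x y; exact. Qed.

Lemma meet_lbl x y : meet x y <== x.
Proof. by case: hX => _ [_ [_ [_ [_ [_ h]]]]]; have [] := h x y. Qed.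

Lemma meet_lbr x y : meet x y <== y.
Proof. by case: hX => _ [_ [_ [_ [_ [_ h]]]]]; have [_ []] := h x y. Qed.

Lemma meet_glb x y z : z <== x -> z <== y -> z <== meet x y.
Proof. by case: hX => _ [_ [_ [_ [_ [_ h]]]]]; have [_ [_]] := h x y; exact. Qed.

Lemma rle_add x y z t : x <== y -> z <== t -> x + z <== y + t.
Proof.
move=> xy zt; apply: (@rle_trans (y + z)); first exact: rle_addr.
by rewrite ![y + _]addrC; apply: rle_addr.
Qed.

Lemma rle_subr x y z : x <== y + z <-> x - z <== y.
Proof.
split=> [/(rle_addr (- z))|/(rle_addr z)]; first by rewrite addrK.
by rewrite subrK.
Qed.

Lemma rle_subl x y z : x <== y - z <-> x + z <== y.
Proof. by have := rle_subr x y (- z); rewrite opprK. Qed.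

Lemma rle_opp x y : x <== y -> - y <== - x.
Proof. by move/(rle_addr (- x - y)); rewrite addrA subrr add0r addrCA subrr addr0. Qed.

Lemma rle_sub0 x y : 0 <== y - x <-> x <== y.
Proof. by have := rle_subl 0 y x; rewrite add0r. Qed.

Lemma rle_addl0 x y : 0 <== y -> x <== x + y.
Proof. by move=> y0; rewrite -{1}[x]addr0; apply: rle_add. Qed.

Lemma rle0_add x y : 0 <== x -> 0 <== y -> 0 <== x + y.
Proof. by move=> x0 y0; rewrite -[0]addr0; apply: rle_add. Qed.

Lemma rle0_scale (a : R) x : 0 <= a -> 0 <== x -> 0 <== a *: x.
Proof. by move=> a0 x0; rewrite -(scaler0 _ a); apply: rle_scale. Qed.

Lemma rle_scale2 (a b : R) x : 0 <== x -> a <= b -> a *: x <== b *: x.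
Proof.
by move=> x0 ab; apply/rle_sub0; rewrite -scalerBl; apply: rle0_scale => //; rewrite subr_ge0.
Qed.

Lemma rle0_unscale (a : R) x : 0 < a -> 0 <== a *: x -> 0 <== x.
Proof.
move=> a0 /(rle_scale (a^-1)); rewrite scaler0 scalerA mulVf ?gt_eqF// scale1r.
by apply; rewrite invr_ge0 ltW.
Qed.

(** * Positive parts and absolute values *)

Definition pospart x := join x 0.

Lemma pospart_ge0 x : 0 <== pospart x. Proof. exact: join_ubr. Qed.
Lemma pospart_ge x : x <== pospart x. Proof. exact: join_ubl. Qed.
Lemma pospart_le x y : x <== y -> 0 <== y -> pospart x <== y.
Proof. exact: join_lub. Qed.
Hint Resolve pospart_ge0 pospart_ge : core.

Lemma pospart_mono x y : x <== y -> pospart x <== pospart y.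
Proof. by move=> xy; apply: pospart_le => //; exact: (rle_trans xy). Qed.

Lemma pospart_opp x : pospart (- x) = pospart x - x.
Proof.
apply: rle_anti.
  by apply: pospart_le; [rewrite -{1}[- x]add0r; apply: rle_addr|apply/rle_sub0].
apply/rle_subr; apply: pospart_le; last by apply/rle_subr; rewrite sub0r.
by rewrite addrC; apply: rle_addl0.
Qed.

Lemma pospart_decomp x : x = pospart x - pospart (- x).
Proof. by rewrite pospart_opp subKr. Qed.

(** If [z] is below both parts, then [pospart x - z] still dominates [x] and 0, hence dominates
    [pospart x]. *)
Lemma pospart_disjoint x z : z <== pospart x -> z <== pospart (- x) -> z <== 0.
Proof.
rewrite pospart_opp => zx /rle_subl zx'.
have : pospart x <== pospart x - z.
  by apply: pospart_le; [apply/rle_subl; rewrite addrC|apply/rle_sub0].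
by move/(rle_addr (- pospart x)); rewrite subrr addrAC subrr add0r => /rle_opp; rewrite opprK oppr0.
Qed.

(** Together with [meetE], this reduces the lattice operations to positive parts, so a linear map
    compatible with positive parts is a lattice homomorphism. *)
Lemma joinE x y : join x y = y + pospart (x - y).
Proof.
apply: rle_anti.
  apply: join_lub; last exact: rle_addl0.
  by rewrite addrC; apply/rle_subr.
rewrite addrC; apply/rle_subl.
by apply: pospart_le; [apply/rle_addr/join_ubl|apply/rle_sub0/join_ubr].
Qed.

Lemma meetE x y : meet x y = x - pospart (x - y).
Proof.
apply: rle_anti.
  apply/rle_subl; rewrite addrC; apply/rle_subl; apply: pospart_le.
    by apply: rle_add => //; apply/rle_opp/meet_lbr.
  exact/rle_sub0/meet_lbl.
apply: meet_glb; apply/rle_subr; first exact: rle_addl0.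
by rewrite addrC; apply/rle_subr.
Qed.

Local Notation rabs := (rabs join).

Lemma rabs_ge x : x <== rabs x. Proof. exact: join_ubl. Qed.
Lemma rabs_geN x : - x <== rabs x. Proof. exact: join_ubr. Qed.
Lemma rabs_le x y : x <== y -> - x <== y -> rabs x <== y.
Proof. exact: join_lub. Qed.
Hint Resolve rabs_ge rabs_geN : core.

Lemma rabs_ge0 x : 0 <== rabs x.
Proof.
apply: (@rle0_unscale 2%:R); first by rewrite ltr0n.
by rewrite scaler_nat mulr2n -(subrr x); apply: rle_add.
Qed.
Hint Resolve rabs_ge0 : core.

Lemma ge0_rabs x : 0 <== x -> rabs x = x.
Proof.
move=> x0; apply: rle_anti => //; apply: rabs_le => //.
by apply: (rle_trans _ x0); rewrite -oppr0; apply: rle_opp.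
Qed.

Lemma rabs_scale_le (a : R) x : rabs (a *: x) <== `|a| *: rabs x.
Proof.
have [a0|/ltW a0] := ger0P a; apply: rabs_le.
- exact: rle_scale.
- by rewrite -scalerN; apply: rle_scale.
- by rewrite -[a *: x]opprK -scaleNr -scalerN; apply: rle_scale; rewrite ?oppr_ge0.
- by rewrite -scaleNr; apply: rle_scale; rewrite ?oppr_ge0.
Qed.

Lemma ideal_abs (N : set X) x : order_ideal le join N -> N x -> N (rabs x).
Proof.
by move=> [_ [_ [_ solid]]]; apply: solid; rewrite [rabs (rabs x)]ge0_rabs.
Qed.

Lemma ideal_between (N : set X) x z : order_ideal le join N ->
  x <== z -> - x <== z -> N z -> N x.
Proof.
move=> [_ [_ [_ solid]]] xz xz'; apply: solid.
exact: (rle_trans (rabs_le _ _ xz xz')).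
Qed.

Lemma ideal_le (N : set X) x z : order_ideal le join N -> 0 <== x -> x <== z -> N z -> N x.
Proof.
move=> idN x0 xz; apply: ideal_between => //; apply: (rle_trans _ xz).
by apply: (rle_trans _ x0); rewrite -oppr0; apply: rle_opp.
Qed.

Lemma ideal_opp (N : set X) x : order_ideal le join N -> N x -> N (- x).
Proof. by rewrite -scaleN1r => -[_ [_ [+ _]]]; exact. Qed.

Lemma ideal_sub (N : set X) x y : order_ideal le join N -> N x -> N y -> N (x - y).
Proof. by move=> idN Nx /(ideal_opp _ _ idN); case: idN => _ [+ _]; exact. Qed.

Lemma ideal_pospart (N : set X) x : order_ideal le join N -> N x -> N (pospart x).
Proof.
move=> idN /(ideal_abs _ _ idN); apply: ideal_le => //.
exact: pospart_le.
Qed.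

Lemma ideal_unscale (N : set X) (a : R) x : order_ideal le join N -> a != 0 -> N (a *: x) -> N x.
Proof.
move=> [_ [_ [scl _]]] a0 /(scl a^-1).
by rewrite scalerA mulVf// scale1r.
Qed.

(** For an ideal [N] and [v >= 0] this is the ideal generated by [N] and [v]. Asking [1 <= k] makes
    [k] invertible with inverse at most 1. *)
Definition adjoin (N : set X) (v : X) : set X :=
  [set x | exists p k, [/\ N p, 0 <== p, 1 <= k & rabs x <== p + k *: v]].

Lemma adjoin_ideal (N : set X) v : order_ideal le join N -> 0 <== v ->
  order_ideal le join (adjoin N v).
Proof.
move=> idN v0; have [N0 [Nadd [Nscl Nsolid]]] := idN.
split; first by exists 0, 1; split=> //; rewrite ge0_rabs// add0r scale1r.
split=> [x y [p [k [Np p0 k1 hx]]] [q [l [Nq q0 l1 hy]]]|].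
  exists (p + q), (k + l); split; [exact: Nadd|exact: rle0_add|lra|].
  have hxy := rle_add _ _ _ _ hx hy.
  rewrite scalerDl addrACA; apply: (rle_trans _ hxy).
  apply: rabs_le; first exact: rle_add.
  by rewrite opprD; apply: rle_add.
split=> [a x [p [k [Np p0 k1 hx]]]|x y xy [p [k [Np p0 k1 hy]]]].
  exists (`|a| *: p), (`|a| * k + 1); split.
  - exact: Nscl.
  - exact: rle0_scale.
  - by rewrite lerDr mulr_ge0// (le_trans ler01).
  - apply: (rle_trans (rabs_scale_le _ _)).
    apply: (rle_trans (rle_scale _ _ _ (normr_ge0 a) hx)).
    rewrite scalerDr scalerA; apply: rle_add => //.
    by apply: rle_scale2 => //; rewrite lerDl.
by exists p, k; split=> //; apply: (rle_trans xy).
Qed.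

Lemma adjoin_sub (N : set X) v : order_ideal le join N -> 0 <== v -> N `<=` adjoin N v.
Proof.
move=> idN v0 x Nx; exists (rabs x), 1; split=> //; first exact: ideal_abs.
by rewrite scale1r; apply: rle_addl0.
Qed.

Lemma adjoin_mem (N : set X) v : order_ideal le join N -> 0 <== v -> adjoin N v v.
Proof.
by move=> [N0 _] v0; exists 0, 1; split=> //; rewrite ge0_rabs// scale1r add0r.
Qed.

(** * Ideals in the presence of a unit *)

Variable e : X.
Hypothesis he : strong_unit le e.

(** Bounding [e] by itself gives [- l e <= e], that is [(1 + l) e >= 0]. *)
Lemma unit_ge0 : 0 <== e.
Proof.
have [_ /(_ e)[l [l0 [h _]]]] := he.
apply: (@rle0_unscale (1 + l)); first by rewrite ltr_wpDr.
by have := rle_addr (l *: e) _ _ h; rewrite addNr scalerDl scale1r.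
Qed.

Lemma unit_bound x : exists l : R, [/\ 1 <= l, - (l *: e) <== x & x <== l *: e].
Proof.
have [_ /(_ x)[l [l0 [h h']]]] := he; exists (l + 1).
have ll : l *: e <== (l + 1) *: e by apply: rle_scale2; rewrite ?lerDl//; exact: unit_ge0.
split; first by rewrite lerDr.
  by apply: (rle_trans _ h); apply: rle_opp.
exact: (rle_trans h').
Qed.

Lemma ideal_unit (N : set X) : order_ideal le join N -> N e -> N = setT.
Proof.
move=> idN Ne; apply/seteqP; split=> // x _.
have [l [_ h h']] := unit_bound x.
apply: (ideal_between _ _ (l *: e)) => //.
  by rewrite -[l *: e]opprK; apply: rle_opp.
by case: idN => _ [_ [+ _]]; exact.
Qed.

(* If [u] and [v] are disjoint and [e <= p + k v] modulo the ideal, then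
   [u / c <= e] forces [(u / c - p)^+ <= k v], hence [u / c <= p]. *)
Lemma disjoint_ideal (N : set X) u v p (k : R) : order_ideal le join N ->
  0 <== u -> 0 <== v -> (forall z, z <== u -> z <== v -> z <== 0) ->
  N p -> 0 <== p -> 1 <= k -> e <== p + k *: v -> N u.
Proof.
move=> idN u0 v0 disj Np p0 k1 hek.
have [c [c1 _ uc]] := unit_bound u.
have c0 : 0 < c by apply: lt_le_trans c1.
have k0 : 0 < k by apply: lt_le_trans k1.
have ci0 : 0 <= c^-1 by rewrite invr_ge0 ltW.
pose w := c^-1 *: u.
have w0 : 0 <== w by exact: rle0_scale.
have we : w <== e.
  by have := rle_scale _ _ _ ci0 uc; rewrite scalerA mulVf ?scale1r// gt_eqF.
have wu : w <== u.
  by rewrite -[X in _ <== X]scale1r; apply: rle_scale2 => //; rewrite invf_le1.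
pose q := pospart (w - p).
have q_ge0 : 0 <== q by exact: pospart_ge0.
have qkv : q <== k *: v.
  apply: pospart_le; last by apply: rle0_scale => //; exact: ltW.
  by apply/rle_subr; rewrite addrC; apply: (rle_trans we).
have qu : q <== u.
  by apply: pospart_le => //; apply/rle_subr; apply: (rle_trans wu); apply: rle_addl0.
have ki0 : 0 <= k^-1 by rewrite invr_ge0 ltW.
have kq : k^-1 *: q <== 0.
  apply: disj.
    apply: (rle_trans _ qu); rewrite -[X in _ <== X]scale1r.
    by apply: rle_scale2 => //; rewrite invf_le1.
  by have := rle_scale _ _ _ ki0 qkv; rewrite scalerA mulVf ?scale1r// gt_eqF.
have q0 : q <== 0.
  by have := rle_scale _ _ _ (ltW k0) kq; rewrite scaler0 scalerA mulfV ?scale1r// gt_eqF.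
have wp : w <== p by apply/rle_sub0; rewrite -oppr0 -opprB; apply: rle_opp; exact: (rle_trans _ q0).
apply: (ideal_unscale _ c^-1) => //; first by rewrite invr_eq0 gt_eqF.
exact: (ideal_le _ _ p).
Qed.

Lemma maximal_ideal_exists (N : set X) : order_ideal le join N -> ~ N e ->
  exists P : set X, [/\ order_ideal le join P, N `<=` P, ~ P e &
    forall Q : set X, order_ideal le join Q -> P `<=` Q -> ~ Q e -> Q `<=` P].
Proof.
move=> idN Ne.
(* Phrasing properness for [N] united with [A] makes the empty union, produced by the empty chain,
   admissible. *)
pose proper (A : set X) := order_ideal le join (N `|` A) /\ ~ (N `|` A) e.
have [F Fproper Ftot|A [[idA Ae] maxA]] := @Zorn_bigcup X proper; last first.
  exists (N `|` A); split=> //.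
  move=> Q idQ AQ Qe; have [|nQA] := pselect (Q `<=` A); first by move=> h x /h; right.
  exfalso; apply: (maxA Q); first by split=> // x Ax; apply: AQ; right.
  have NQ : N `|` Q = Q by apply/setUidPr => x Nx; apply: AQ; left.
  by split; rewrite NQ.
set U := \bigcup_(B in F) B.
(* Each closure property of an ideal involves at most two elements, and these lie in one common
   admissible set; [set0] serves when both are in [N]. *)
have chain x y : (N `|` U) x -> (N `|` U) y ->
    exists B, [/\ proper B, B `<=` U, (N `|` B) x & (N `|` B) y].
  have sub B : F B -> B `<=` U by move=> FB z Bz; exists B.
  move=> [Nx|[B FB Bx]] [Ny|[C FC Cy]].
  - by exists set0; split=> //; rewrite /proper ?setU0//; left.
  - by exists C; split; [exact: Fproper|exact: sub|left|right].
  - by exists B; split; [exact: Fproper|exact: sub|right|left].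
  - have [BC|CB] := Ftot _ _ FB FC.
      by exists C; split; [exact: Fproper|exact: sub|right; exact: BC|right].
    by exists B; split; [exact: Fproper|exact: sub|right|right; exact: CB].
have NU B : B `<=` U -> N `|` B `<=` N `|` U by move=> BU; apply: setUS.
split; last by move=> Ue; have [B [[_ +] _ Be _]] := chain _ _ Ue Ue.
split; first by left; case: idN.
split=> [x y /chain h /h[B [[[_ [add _]] _] BU Bx By]]|].
  by apply: (NU B) => //; apply: add.
split=> [a x Ux|x y xy Uy].
  have [B [[[_ [_ [scl _]]] _] BU Bx _]] := chain _ _ Ux Ux.
  by apply: (NU B) => //; apply: scl.
have [B [[[_ [_ [_ solid]]] _] BU By _]] := chain _ _ Uy Uy.
by apply: (NU B) => //; apply: solid xy By.
Qed.

(** * Characters from maximal ideals *)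

Section maximal_ideal.
Variable P : set X.
Hypothesis idP : order_ideal le join P.
Hypothesis Pe : ~ P e.
Hypothesis maxP : forall Q : set X, order_ideal le join Q -> P `<=` Q -> ~ Q e -> Q `<=` P.

(** Otherwise the ideal generated by [P] and [v] would be proper and strictly larger than [P]. *)
Lemma maximal_unit_le v : 0 <== v -> ~ P v ->
  exists p k, [/\ P p, 0 <== p, 1 <= k & e <== p + k *: v].
Proof.
move=> v0 Pv; have [[p [k [? ? ? h]]]|Qe] := pselect (adjoin P v e).
  by exists p, k; split=> //; apply: (rle_trans _ h).
exfalso; apply: Pv; apply: (maxP (adjoin P v)) => //.
- exact: adjoin_ideal.
- exact: adjoin_sub.
- exact: adjoin_mem.
Qed.

(** The two parts of [x] are disjoint, so if one is outside [P], [disjoint_ideal] puts the other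
    inside. Hence the quotient by [P] is totally ordered. *)
Lemma maximal_prime x : P (pospart x) \/ P (pospart (- x)).
Proof.
have [|nP] := pselect (P (pospart (- x))); [by right|left].
have [p [k [Pp p0 k1 h]]] := maximal_unit_le (pospart (- x)) (pospart_ge0 _) nP.
by apply: (disjoint_ideal P _ _ p k) h => // z; exact: pospart_disjoint.
Qed.

Lemma ideal_scale_unit (c : R) : P (c *: e) -> c = 0.
Proof.
by move=> Pc; apply/eqP; apply: contra_notT Pe => c0; exact: ideal_unscale Pc.
Qed.

Lemma maximal_closed y :
  (forall d : R, 0 < d -> P (pospart (y - d *: e))) -> P (pospart y).
Proof.
move=> H; apply: contrapT => nP.
have [p [k [Pp p0 k1 h]]] := maximal_unit_le (pospart y) (pospart_ge0 _) nP.
have k0 : 0 < k by apply: lt_le_trans k1.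
(* With [k d = 1/2], replacing [pospart y] by [q + d e] in [e <= p + k (pospart y)] leaves
   [e / 2 <= p + k q], an element of [P]. *)
pose d := (2 * k)^-1; have d0 : 0 < d by rewrite invr_gt0 mulr_gt0.
pose q := pospart (y - d *: e).
have hq : pospart y <== q + d *: e.
  apply: pospart_le; first by apply/rle_subr; exact: pospart_ge.
  apply: rle0_add; first exact: pospart_ge0.
  by apply: rle0_scale unit_ge0; exact: ltW.
apply: Pe; apply: (ideal_unscale _ 2^-1) => //.
apply: (ideal_le _ _ (p + k *: q)) => //.
- by apply: rle0_scale unit_ge0; rewrite invr_ge0.
- have := rle_trans h (rle_add _ _ _ _ (rle_refl p) (rle_scale _ _ _ (ltW k0) hq)).
  have -> : k *: (q + d *: e) = k *: q + 2^-1 *: e.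
    by rewrite scalerDr scalerA; congr (_ + _ *: _); rewrite /d invfM mulrCA divff ?mulr1// gt_eqF.
  move/(rle_addr (- (2^-1 *: e))); rewrite addrA addrK -[X in X - _]scale1r -scalerBl.
  by have -> : 1 - 2^-1 = 2^-1 :> R by lra.
- by case: idP => _ [add [scl _]]; apply: add => //; apply: scl; exact: H.
Qed.

(** The value is a Dedekind cut: the supremum of the [t] with [t e <= x] modulo [P]. Primeness
    handles levels above the supremum, downward closure those below, and [maximal_closed] removes
    the margin [d]. *)
Lemma maximal_value x : exists r : R, P (x - r *: e).
Proof.
have [l [l1 lx xl]] := unit_bound x.
pose A := [set t : R | P (pospart (t *: e - x))].
have P0 : P 0 by case: idP.
have pos0 y : y <== 0 -> pospart y = 0.
  by move=> y0; apply: rle_anti; [exact: pospart_le|exact: pospart_ge0].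
have down s t : s <= t -> A t -> A s.
  move=> st; apply: (ideal_le P) => //.
  by apply: pospart_mono; apply: rle_addr; apply: rle_scale2 => //; exact: unit_ge0.
have Al : A (- l).
  rewrite /A/= pos0//; apply/rle_subr; rewrite add0r scaleNr//.
have Aub : ubound A l.
  move=> t At; rewrite leNgt; apply/negP => lt.
  have : P ((t - l) *: e).
    apply: (ideal_le _ _ _ idP _ _ At).
      by apply: rle0_scale unit_ge0; rewrite subr_ge0 ltW.
    apply: (rle_trans _ (pospart_ge _)); rewrite scalerBl.
    by apply: rle_add => //; exact: rle_opp.
  by move/ideal_scale_unit/eqP; rewrite subr_eq0 gt_eqF.
have supA : has_sup A by split; [exists (- l)|exists l].
exists (sup A).
rewrite [X in P X]pospart_decomp; apply: ideal_sub => //; apply: maximal_closed => d d0.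
  rewrite -addrA -opprD -scalerDl.
  have [h|] := maximal_prime (x - (sup A + d) *: e); first exact: h.
  rewrite opprB => h; exfalso.
  have := ub_le_sup (proj2 supA) h; lra.
rewrite opprB addrAC -scalerBl.
have [t At lt] := sup_adherent d0 supA.
exact: down (ltW lt) At.
Qed.

Lemma maximal_character : exists xi : X -> R, forall x, P (x - xi x *: e).
Proof. by have [xi Pxi] := choice maximal_value; exists xi. Qed.

End maximal_ideal.

Variable N : set X.
Hypothesis idN : order_ideal le join N.
Hypothesis Ne : ~ N e.

(** Compatibility with positive parts encodes the lattice homomorphism property; see [char_join] and
    [char_meet]. *)
Definition lattice_character (xi : X -> R) :=
  [/\ linear_functional xi, xi e = 1, (forall x, N x -> xi x = 0) &
      forall x, xi (pospart x) = Num.max (xi x) 0].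

Lemma lattice_character_of_maximal (P : set X) (xi : X -> R) :
  order_ideal le join P -> ~ P e ->
  (forall Q : set X, order_ideal le join Q -> P `<=` Q -> ~ Q e -> Q `<=` P) ->
  N `<=` P -> (forall x, P (x - xi x *: e)) -> lattice_character xi.
Proof.
move=> idP Pe maxP NP Pxi; have [_ [Padd [Pscl _]]] := idP.
(* As [P] contains no nonzero multiple of [e], the coefficient of [x] modulo [P] is unique;
   linearity then follows by exhibiting elements of [P]. *)
have uniq x r : P (x - r *: e) -> xi x = r.
  move=> Pr; apply/eqP; rewrite -subr_eq0; apply/eqP/(ideal_scale_unit _ idP Pe).
  have := ideal_sub _ _ _ idP Pr (Pxi x).
  by rewrite opprB addrC addrA subrK scalerBl.
have xilin : linear_functional xi.
  move=> a x y; apply: uniq.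
  have := Padd _ _ (Pscl a _ (Pxi x)) (Pxi y).
  by rewrite scalerBr scalerA addrACA -opprD -scalerDl.
have xiP x : P x -> xi x = 0 by move=> Px; apply: uniq; rewrite scale0r subr0.
have xi0 x : 0 <== x -> 0 <= xi x.
  move=> x0; rewrite leNgt; apply/negP => xn.
  have : P ((- xi x) *: e).
    apply: (ideal_le _ _ _ idP _ _ (Pxi x)).
      by apply: rle0_scale unit_ge0; rewrite oppr_ge0 ltW.
    by rewrite scaleNr addrC; exact: rle_addl0.
  by move/(ideal_scale_unit _ idP Pe)/eqP; rewrite oppr_eq0 lt_eqF.
split=> //; first by apply: uniq; rewrite scale1r subrr; case: idP.
  by move=> x /NP /xiP.
move=> x; have xE : xi x = xi (pospart x) - xi (pospart (- x)).
  by rewrite {1}[x]pospart_decomp -scaleN1r addrC xilin mulN1r addrC.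
have p1 := xi0 _ (pospart_ge0 x); have p2 := xi0 _ (pospart_ge0 (- x)).
rewrite xE; have [/xiP h|/xiP h] := maximal_prime _ idP maxP x; rewrite h.
  by rewrite max_r//; lra.
by rewrite max_l//; lra.
Qed.

(** * Separation by characters *)

Hypothesis Ncl : uniformly_closed le join N.

Lemma uniformly_closed_cut w : 0 <== w -> ~ N w ->
  exists2 eps : R, 0 < eps & ~ N (pospart (w - eps *: e)).
Proof.
move=> w0 Nw; apply: contrapT => H; apply: Nw.
have e_neq0 : e <> 0 by case: he.
apply: (Ncl _ (fun n => pospart (w - n.+1%:R^-1 *: e)) e (fun n => n.+1%:R^-1)) => //.
- by move=> n; apply: contrapT => h; apply: H; exists n.+1%:R^-1; rewrite ?invr_gt0.
- exact: unit_ge0.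
- by move=> n; rewrite lef_pV2 ?posrE ?ltr0n// ler_nat.
- exact: cvg_harmonic.
- move=> n; set c : R := _^-1.
  have ce : 0 <== c *: e by apply: rle0_scale unit_ge0; rewrite invr_ge0.
  apply: rabs_le.
    apply: (rle_trans _ ce); rewrite -(subrr w); apply: rle_addr.
    by apply: pospart_le => //; apply/rle_subr; exact: rle_addl0.
  rewrite opprB; apply/rle_subr; rewrite addrC; apply/rle_subr; exact: pospart_ge.
Qed.

Lemma lattice_character_separates w : 0 <== w -> ~ N w ->
  exists2 xi, lattice_character xi & 0 < xi w.
Proof.
move=> w0 /(uniformly_closed_cut _ w0)[eps eps0 Nu].
pose v := pospart (- (w - eps *: e)).
have v0 : 0 <== v by exact: pospart_ge0.
(* If [e] were in the enlarged ideal, [disjoint_ideal] would put [pospart (w - eps *: e)] in [N]. *)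
have Qe : ~ adjoin N v e.
  move=> [p [k [Np p0 k1 h]]]; apply: Nu.
  apply: (disjoint_ideal N _ v p k) (rle_trans (rabs_ge _) h) => // z.
  exact: pospart_disjoint.
have [P [idP QP Pe maxP]] := maximal_ideal_exists _ (adjoin_ideal _ _ idN v0) Qe.
have [xi Pxi] := maximal_character _ idP Pe maxP.
have hxi : lattice_character xi.
  apply: (lattice_character_of_maximal P) => //.
  by apply: subset_trans QP; exact: adjoin_sub.
exists xi => //; apply: (lt_le_trans eps0).
have Pv : P v by apply: QP; exact: adjoin_mem.
rewrite leNgt; apply/negP => xw; apply: Pe.
(* If [xi w < eps], then [(eps - xi w) e] is the sum of [eps e - w] and [w - (xi w) e], whose
   positive parts are both in [P]. *)
apply: (ideal_unscale _ (eps - xi w)) => //; first by rewrite subr_eq0 gt_eqF.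
have [_ [Padd _]] := idP.
apply: (ideal_le _ _ (v + pospart (w - xi w *: e))) => //.
- by apply: rle0_scale unit_ge0; rewrite subr_ge0 ltW.
- apply: (rle_trans _ (rle_add _ _ _ _ (pospart_ge _) (pospart_ge _))).
  by rewrite opprB addrA subrK scalerBl.
- by apply: Padd => //; exact: ideal_pospart.
Qed.

Lemma pospart_id x : 0 <== x -> pospart x = x.
Proof. by move=> x0; apply: rle_anti => //; exact: pospart_le. Qed.

Section lattice_character_theory.
Variable xi : X -> R.
Hypothesis hxi : lattice_character xi.

Lemma charD x y : xi (x + y) = xi x + xi y.
Proof. by case: hxi => /(_ 1 x y); rewrite scale1r mul1r. Qed.

Lemma char0 : xi 0 = 0.
Proof. by have := charD 0 0; rewrite addr0; lra. Qed.

Lemma charZ a x : xi (a *: x) = a * xi x.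
Proof. by case: hxi => /(_ a x 0); rewrite addr0 char0 addr0. Qed.

Lemma charB x y : xi (x - y) = xi x - xi y.
Proof. by rewrite charD -scaleN1r charZ mulN1r. Qed.

Lemma charZunit a : xi (a *: e) = a.
Proof. by rewrite charZ; case: hxi => _ ->; rewrite mulr1. Qed.

Lemma char_join x y : xi (join x y) = Num.max (xi x) (xi y).
Proof.
rewrite joinE charD; case: hxi => _ _ _ ->; rewrite charB.
by case: ltP => ?; case: ltP => ?; lra.
Qed.

Lemma char_meet x y : xi (meet x y) = Num.min (xi x) (xi y).
Proof.
rewrite meetE charB; case: hxi => _ _ _ ->; rewrite charB.
by case: ltP => ?; case: ltP => ?; lra.
Qed.

Lemma char_ge0 x : 0 <== x -> 0 <= xi x.
Proof.
by move=> x0; rewrite -(pospart_id _ x0); case: hxi => _ _ _ ->; rewrite le_max lexx orbT.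
Qed.

Lemma char_le x y : x <== y -> xi x <= xi y.
Proof. by move/rle_sub0/char_ge0; rewrite charB subr_ge0. Qed.

Lemma char_norm_dual : norm_dual le join e xi.
Proof.
split; first by case: hxi.
exists 1 => x; rewrite mul1r; apply: lb_le_inf.
  have [l [l1 h h']] := unit_bound x.
  exists l; split; first exact: le_trans l1.
  by apply: rabs_le => //; rewrite -[l *: e]opprK; exact: rle_opp.
move=> l [_ hl]; rewrite ler_norml -{1}(charZunit l) -{2}(charZunit l).
rewrite lerNl -sub0r -char0 -charB sub0r.
by apply/andP; split; apply: char_le; exact: (rle_trans _ hl).
Qed.

(* [xi] kills [x - xi x *: e] and, being a lattice homomorphism, its positive and
   negative parts; so does every positive functional below a multiple of [xi]. *)
Lemma char_ext : ext_N le join e N xi.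
Proof.
have hD : Delta_N le join e N xi.
  split; first by split; [exact: char_norm_dual|exact: char_ge0].
  by case: hxi => _ ? ? _.
have part eta zeta l : Delta_N le join e N eta -> Delta_N le join e N zeta ->
    0 < l -> 0 < 1 - l -> xi = (fun x => l * eta x + (1 - l) * zeta x) -> eta = xi.
  move=> [[[elin _] e0] [e1 _]] [[_ z0] _] l0 l1 xiE.
  have null x : 0 <== x -> xi x = 0 -> eta x = 0.
    move=> x0; rewrite {1}xiE => /eqP.
    have p1 := e0 _ x0; have p2 := z0 _ x0.
    rewrite paddr_eq0 ?mulr_ge0 ?(ltW l0) ?(ltW l1)// mulf_eq0 gt_eqF//=.
    by move=> /andP[/eqP].
  apply/funext => x; pose y := x - xi x *: e.
  have xiy : xi y = 0 by rewrite charB charZunit subrr.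
  have etaD u v : eta (u + v) = eta u + eta v.
    by have := elin 1 u v; rewrite scale1r mul1r.
  have ey : eta y = 0.
    rewrite [y]pospart_decomp -scaleN1r addrC elin.
    rewrite (null (pospart (- y))) ?(null (pospart y)) ?mulr0 ?addr0//.
    - by case: hxi => _ _ _ ->; rewrite xiy maxxx.
    - by case: hxi => _ _ _ ->; rewrite -sub0r charB char0 xiy subrr maxxx.
  have -> : x = xi x *: e + y by rewrite addrC subrK.
  by rewrite elin charD charZunit e1 mulr1 ey xiy.
split=> // eta zeta l etaD zetaD /andP[l0 l1] xiE.
rewrite (part eta zeta l)// ?subr_gt0//.
apply/esym/(part zeta eta (1 - l)) => //; rewrite ?subKr ?subr_gt0//.
by rewrite xiE; apply/funext => x; rewrite addrC.
Qed.

End lattice_character_theory.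

(** * Slices and homogeneity *)

Variable V : X -> R.
Hypothesis Vnorm : normalized_fun e V.
Hypothesis Vmono : monotone_fun le V.
Hypothesis Vadd : unit_additive e V.
Hypothesis Vmod : unit_modular join meet e V.
Hypothesis Vinv : N_invariant N V.

(** By separation [pospart (x - y)] lies in [N], so adding it to [y] does not change [V y]; the sum
    equals [x + pospart (y - x)], which is above [x]. From here on, elements of [X] are compared
    through their values as real functions. *)
Lemma le_V x y : (forall xi, lattice_character xi -> xi x <= xi y) -> V x <= V y.
Proof.
move=> H; pose z := y - x.
have Nz : N (pospart (- z)).
  apply: contrapT => nN.
  have [xi hxi] := lattice_character_separates _ (pospart_ge0 _) nN.
  case: (hxi) => _ _ _ ->; rewrite lt_max ltxx orbF opprB charB// subr_gt0.
  by rewrite ltNge H.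
have -> : V y = V (y + pospart (- z)).
  by apply: Vinv; rewrite opprD addrA subrr sub0r; exact: ideal_opp.
have -> : y + pospart (- z) = x + pospart z.
  by rewrite pospart_opp addrCA addrC opprB addrC (addrC y) subrK addrC.
by apply: Vmono; apply: rle_addl0; exact: pospart_ge0.
Qed.

Lemma eq_V x y : (forall xi, lattice_character xi -> xi x = xi y) -> V x = V y.
Proof. by move=> H; apply/eqP; rewrite eq_le !le_V// => xi /H ->. Qed.

Lemma V_translate x l : V (x + l *: e) = V x + l.
Proof.
have [l0|/ltW l0] := leP 0 l; first by rewrite Vadd// Vnorm.
have := Vadd (x + l *: e) (- l); rewrite oppr_ge0 => /(_ l0).
by rewrite Vnorm scaleNr addrK => ->; rewrite addrNK.
Qed.

Definition slice x a b := join (meet x (b *: e)) (a *: e) - a *: e.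
Definition cut x t := V (meet x (t *: e)).

Lemma char_slice xi x a b : lattice_character xi ->
  xi (slice x a b) = Num.max (Num.min (xi x) b) a - a.
Proof. by move=> hxi; rewrite charB// char_join// char_meet// !charZunit. Qed.

(** Unit-modularity at level [a] is applied to [x] truncated at [b]; truncating further at [a] gives
    back the truncation of [x] at [a]. *)
Lemma V_slice x a b : a <= b -> V (slice x a b) = cut x b - cut x a.
Proof.
move=> ab; have := Vmod (meet x (b *: e)) a; rewrite Vnorm.
rewrite -[X in V X + _](subrK (a *: e)) V_translate -/(slice x a b).
have -> : V (meet (meet x (b *: e)) (a *: e)) = cut x a.
  apply: eq_V => xi hxi; rewrite !char_meet// !charZunit//.
  by rewrite -minA (min_r ab).
rewrite /cut; lra.
Qed.

Lemma le_cutB x y a b c d : a <= b -> c <= d ->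
  (forall xi, lattice_character xi ->
     Num.max (Num.min (xi x) b) a - a <= Num.max (Num.min (xi y) d) c - c) ->
  cut x b - cut x a <= cut y d - cut y c.
Proof.
by move=> ab cd H; rewrite -!V_slice//; apply: le_V => xi hxi; rewrite !char_slice// H.
Qed.

Lemma cut_full x t : (forall xi, lattice_character xi -> xi x <= t) -> cut x t = V x.
Proof.
by move=> H; apply: eq_V => xi hxi; rewrite char_meet// charZunit// min_l// H.
Qed.

Lemma cut_low x t : (forall xi, lattice_character xi -> t <= xi x) -> cut x t = t.
Proof.
move=> H; rewrite -[RHS]Vnorm; apply: eq_V => xi hxi.
by rewrite char_meet// charZunit// min_r// H.
Qed.

Lemma cut_le x t : cut x t <= V x.
Proof. by apply: le_V => xi hxi; rewrite char_meet// ge_min lexx. Qed.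

Lemma cut_le_level x t : cut x t <= t.
Proof.
rewrite -[leRHS]Vnorm; apply: le_V => xi hxi.
by rewrite char_meet// ge_min lexx orbT.
Qed.

(* With mesh [d], the slice of [n x] between [s] and [s + d] is dominated by the
   slice of [x] one step below [s / n] and dominates the one a step above. *)
Lemma V_scale_approx n x d : (forall xi, lattice_character xi -> 0 <= xi x) -> 0 < d ->
  (0 < n)%N -> n%:R * (V x - d) <= V (n%:R *: x) <= n%:R * (V x + d).
Proof.
move=> x0 d0 n0; have n0' : 0 < n%:R :> R by rewrite ltr0n.
have [l [l1 _ xl]] := unit_bound x.
have ld : 0 <= l / d by rewrite divr_ge0 ?ltW// (lt_le_trans ltr01).
(* Enough steps of size [d] to cover the range of [x]. *)
set K := Num.Def.archi_bound (l / d).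
have xK xi : lattice_character xi -> xi x <= K%:R * d.
  move=> hxi; have := char_le _ hxi _ _ xl; rewrite charZunit// => /le_trans; apply.
  by rewrite -ler_pdivrMr//; exact/ltW/archi_boundP.
pose G t := cut (n%:R *: x) t.
pose f k : R := G (n%:R * (k%:R * d)).
have step k : f k = G ((n * k + 0)%:R * d) /\ f k.+1 = G ((n * k + n)%:R * d).
  by rewrite /f addn0 -mulnSr !natrM !mulrA.
have fK : f K = V (n%:R *: x).
  by apply: cut_full => xi hxi; rewrite charZ// ler_pM2l// xK.
have f0 : f 0%N = 0.
  rewrite /f mul0r mulr0 /G; apply: cut_low => xi hxi.
  by rewrite charZ//; apply: mulr_ge0 (x0 _ hxi); exact: ltW.
apply/andP; split.
(* Lower bound: [g] looks one step up. Each of the [n] slices of [n x] in block [k] is full wherever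
   [x] exceeds [(k+1) d]. The loss is [g 0], at most [d]. *)
- pose g (k : nat) := cut x (k.+1%:R * d).
  have : n%:R * (g K - g 0%N) <= f K - f 0%N.
    have := @ler_sum_increments R (fun k => n%:R * g k) f 1 K; rewrite !mul1r mulrBr; apply.
    move=> k _; rewrite mul1r -mulrBr.
    have := @ler_sum_increments R (fun j => j%:R * (g k.+1 - g k))
      (fun j => G ((n * k + j)%:R * d)) 1 n.
    have [<- <-] := step k.
    rewrite !mul1r mul0r subr0; apply=> j jn.
    rewrite mul1r -mulrBl -[j.+1%:R]natr1 addrAC subrr add0r mul1r /g /G.
    apply: le_cutB.
    + by rewrite ler_pM2r// ler_nat.
    + by rewrite ler_pM2r// ler_nat addnS.
    move=> xi hxi; rewrite charZ// addnS -[k.+2%:R]natr1 -[(n * k + j).+1%:R]natr1.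
    set v := xi x; set t := k.+1%:R; set s := (n * k + j)%:R.
    have st : s + 1 <= n%:R * t.
      by rewrite natr1 -natrM ler_nat mulnSr -addnS leq_add2l.
    have std : (s + 1) * d <= n%:R * (t * d) by rewrite mulrA ler_pM2r.
    have [vt|vt] := leP v (t * d).
      have e1 : Num.max (Num.min v ((t + 1) * d)) (t * d) = t * d.
        by apply/max_r; rewrite ge_min vt.
      by rewrite e1 subrr subr_ge0 le_max lexx orbT.
    have nv : (s + 1) * d <= n%:R * v by apply: (le_trans std); rewrite ler_pM2l// ltW.
    rewrite (min_r nv) (@max_l _ _ ((s + 1) * d)) ?ler_pM2r ?lerDl//.
    have : Num.max (Num.min v ((t + 1) * d)) (t * d) <= (t + 1) * d.
      by rewrite ge_max ge_min lexx orbT/= ler_pM2r// lerDl.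
    lra.
  have -> : g K = V x.
    apply: cut_full => xi hxi; apply: (le_trans (xK xi hxi)).
    by rewrite ler_pM2r// ler_nat.
  rewrite fK f0 subr0; apply: le_trans; rewrite ler_pM2l// lerD2l lerN2.
  by have := cut_le_level x (1 * d); rewrite mul1r /g mul1r.
(* Upper bound: [g] looks one step down. The slices of [n x] in block [k] vanish where [x <= k d];
   elsewhere the slice of [x] just below [k d] is full. Since [x >= 0] on characters,
   [g 0 = - d]. *)
- pose g (k : nat) := cut x (k%:R * d - d).
  have : f K - f 0%N <= n%:R * (g K - g 0%N).
    apply: ler_sum_increments => k _.
    have := @ler_sum_increments R (fun j => G ((n * k + j)%:R * d)) (fun j => j%:R)
      (g k.+1 - g k) n.
    have [<- <-] := step k.
    rewrite subr0 [_ * n%:R]mulrC; apply=> j jn.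
    rewrite -[j.+1%:R]natr1 addrAC subrr add0r mulr1 /g /G.
    apply: le_cutB.
    + by rewrite ler_pM2r// ler_nat addnS.
    + by rewrite lerD2r ler_pM2r// ler_nat.
    move=> xi hxi; rewrite charZ// addnS -[k.+1%:R]natr1 -[(n * k + j).+1%:R]natr1.
    set v := xi x; set t := k%:R; set s := (n * k + j)%:R.
    have st : n%:R * t <= s by rewrite -natrM ler_nat leq_addr.
    have std : n%:R * (t * d) <= s * d by rewrite mulrA ler_pM2r.
    have [vt|vt] := leP v (t * d).
      have nv : n%:R * v <= s * d by apply: (le_trans _ std); rewrite ler_pM2l.
      have e1 : Num.max (Num.min (n%:R * v) ((s + 1) * d)) (s * d) = s * d.
        by apply/max_r; rewrite ge_min nv.
      by rewrite e1 subrr subr_ge0 le_max lexx orbT.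
    have e2 : (t + 1) * d - d = t * d by ring.
    rewrite e2 (min_r (ltW vt)) (@max_l _ _ (t * d)); last by rewrite gerBl ltW.
    have : Num.max (Num.min (n%:R * v) ((s + 1) * d)) (s * d) <= (s + 1) * d.
      by rewrite ge_max ge_min lexx orbT/= ler_pM2r// lerDl.
    lra.
  have -> : g 0%N = - d.
    rewrite /g mul0r sub0r; apply: cut_low => xi hxi.
    by apply: (le_trans _ (x0 xi hxi)); rewrite oppr_le0 ltW.
  rewrite fK f0 subr0 opprK => /le_trans; apply; rewrite ler_pM2l// lerD2r.
  exact: cut_le.
Qed.

Lemma V_scale n x : (forall xi, lattice_character xi -> 0 <= xi x) -> (0 < n)%N ->
  V (n%:R *: x) = n%:R * V x.
Proof.
move=> x0 n0; have n0' : 0 < n%:R :> R by rewrite ltr0n.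
apply/eqP; rewrite eq_le; apply/andP; split; apply/ler_addgt0Pr => d d0.
  (* Mesh [d / n] turns the error [n * mesh] into [d]. *)
  have /andP[_] := V_scale_approx n x (d / n%:R) x0 (divr_gt0 d0 n0') n0.
  by rewrite mulrDr mulrCA divff ?mulr1// gt_eqF.
have /andP[+ _] := V_scale_approx n x (d / n%:R) x0 (divr_gt0 d0 n0') n0.
by rewrite mulrBr mulrCA divff ?mulr1 ?gt_eqF// lerBlDr.
Qed.

(** * The capacity *)

(* By [char_ext] lattice characters are extreme points; they are enough to
   separate, so extreme points outside this class are simply ignored. *)
Definition cap_majorants (A : set (X -> R)) : set X :=
  [set s | forall xi, lattice_character xi -> 0 <= xi s <= 1 /\ (A xi -> xi s = 1)].

Definition cap (A : set (X -> R)) : R := inf [set V s | s in cap_majorants A].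

Lemma V0 : V 0 = 0. Proof. by rewrite -(scale0r e) Vnorm. Qed.

Lemma cap_majorants_lbound A : lbound [set V s | s in cap_majorants A] 0.
Proof.
by move=> _ [s hs <-]; rewrite -V0; apply: le_V => xi hxi; rewrite char0//; have [/andP[]] := hs _ hxi.
Qed.

Lemma cap_majorants_unit A : cap_majorants A e.
Proof. by move=> xi [_ -> _ _]; rewrite ler01 lexx. Qed.

Lemma cap_le_V A s : cap_majorants A s -> cap A <= V s.
Proof. by move=> hs; apply: ge_inf; [exists 0; exact: cap_majorants_lbound|exists s]. Qed.

Lemma le_cap A (r : R) : (forall s, cap_majorants A s -> r <= V s) -> r <= cap A.
Proof.
move=> H; apply: lb_le_inf; first by exists (V e), e => //; exact: cap_majorants_unit.
by move=> _ [s hs <-]; exact: H.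
Qed.

Lemma cap_ge0 A : 0 <= cap A.
Proof. by apply: le_cap => s hs; apply: (cap_majorants_lbound A); exists s. Qed.

Lemma cap_mono A B : A `<=` B -> cap A <= cap B.
Proof.
move=> AB; apply: le_cap => s hs; apply: cap_le_V => xi hxi.
by have [? h] := hs _ hxi; split=> // /AB.
Qed.

Lemma cap_null A : (forall xi, lattice_character xi -> ~ A xi) -> cap A = 0.
Proof.
move=> HA; apply/eqP; rewrite eq_le cap_ge0 andbT -V0; apply: cap_le_V => xi hxi.
by rewrite char0// lexx ler01; split=> // /(HA _ hxi).
Qed.

Lemma cap_full A : lattice_character `<=` A -> cap A = 1.
Proof.
have Ve : V e = 1 by rewrite -[e]scale1r Vnorm.
move=> HA; apply/eqP; rewrite eq_le -Ve; apply/andP; split.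
  by apply: cap_le_V; exact: cap_majorants_unit.
apply: le_cap => s hs; apply: le_V => xi hxi.
by have [_ ->] := hs _ hxi; [case: hxi => _ ->|exact: HA].
Qed.

Let ext := ext_N le join e N.

Lemma cap_normalized : normalized_capacity ext cap.
Proof.
split; first by apply: cap_null => xi _ [].
split; first by apply: cap_full => xi; exact: char_ext.
by move=> A B _ _; exact: cap_mono.
Qed.

(** * The Choquet integral *)

Definition level x (t : R) := cap [set xi | ext xi /\ t <= xi x].

Lemma level_nonincreasing x : {homo level x : s t / s <= t >-> t <= s}.
Proof. by move=> s t st; apply: cap_mono => xi [? h]; split=> //; exact: le_trans h. Qed.

Lemma level_low x t : (forall xi, lattice_character xi -> t <= xi x) -> level x t = 1.
Proof.
by move=> H; apply: cap_full => xi hxi; split; [exact: char_ext|exact: H].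
Qed.

Lemma level_high x t : (forall xi, lattice_character xi -> xi x < t) -> level x t = 0.
Proof.
by move=> H; apply: cap_null => xi hxi [_]; rewrite leNgt H.
Qed.

(** Heights [1/(m+1)] are used because homogeneity is available for natural multiples: [m+1] times
    the slice has values in [0, 1]. *)
Lemma cutB_bounds x (t : R) (m : nat) :
  m.+1%:R^-1 * level x (t + m.+1%:R^-1) <= cut x (t + m.+1%:R^-1) - cut x t
    <= m.+1%:R^-1 * level x t.
Proof.
set h : R := m.+1%:R^-1; have h0 : 0 < h by rewrite invr_gt0 ltr0n.
have m0 : 0 < m.+1%:R :> R by rewrite ltr0n.
have tth : t <= t + h by rewrite lerDl ltW.
pose s := slice x t (t + h).
have sE xi : lattice_character xi -> xi s = Num.max (Num.min (xi x) (t + h)) t - t.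
  by move=> hxi; rewrite char_slice.
have s0 xi : lattice_character xi -> 0 <= xi s.
  by move=> hxi; rewrite sE// subr_ge0 le_max lexx orbT.
have sh xi : lattice_character xi -> xi s <= h.
  by move=> hxi; rewrite sE// lerBlDl ge_max tth ge_min lexx orbT.
have VS : V (m.+1%:R *: s) = m.+1%:R * (cut x (t + h) - cut x t).
  by rewrite V_scale// V_slice.
apply/andP; split; rewrite /h.
  rewrite ler_pdivrMl// -VS; apply: cap_le_V => xi hxi; rewrite charZ//; split.
    apply/andP; split; first by apply: mulr_ge0 (s0 _ hxi); exact: ltW.
    by rewrite -ler_pdivlMl// mulr1 sh.
  move=> [_ tx]; rewrite sE// min_r// max_l// addrAC subrr add0r.
  by rewrite mulfV// gt_eqF.
(* Every majorant [r] dominates the rescaled slice: [r] is 1 where [x >= t], and the slice vanishes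
   elsewhere. *)
rewrite ler_pdivlMl// -VS; apply: le_cap => r hr; apply: le_V => xi hxi.
rewrite charZ//; have [/andP[r0 r1] hr1] := hr _ hxi.
have [tx|xt] := leP t (xi x).
  rewrite hr1; first by rewrite -ler_pdivlMl// mulr1 sh.
  by split=> //; exact: char_ext.
have -> : xi s = 0 by rewrite sE// max_r ?subrr// ge_min (ltW xt).
by rewrite mulr0.
Qed.

Lemma V_choquet x : (V x)%:E = choquet ext cap (fun xi => xi x).
Proof.
have [l [l1 lx xl]] := unit_bound x.
have l0 : 0 <= l by apply: le_trans l1.
(* A natural bound, so that the truncated ranges have integer length; strictness makes [level x]
   vanish from [M] on. *)
set M := (Num.Def.archi_bound l).
have lM : l < M%:R by exact: archi_boundP.
have xM xi : lattice_character xi -> xi x < M%:R.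
  move=> hxi; apply: le_lt_trans lM.
  by have := char_le _ hxi _ _ xl; rewrite charZunit.
have Mx xi : lattice_character xi -> - M%:R <= xi x.
  move=> hxi; have := char_le _ hxi _ _ lx.
  by rewrite -sub0r charB// char0// charZunit// sub0r; apply: le_trans; rewrite lerN2 ltW.
have M0 : 0 <= M%:R :> R by rewrite ler0n.
have pos : (\int[@lebesgue_measure R]_(t in `[0%R, +oo[) (level x t)%:E = (V x - cut x 0)%:E)%E.
  rewrite (@itv_bndbnd_setU _ _ _ (BLeft M%:R)) ?bnd_simp//.
  rewrite ge0_integral_setU//=; first last.
  - apply/disj_setPS => y [/=]; rewrite 2!in_itv/= => /andP[_ yM] /andP[].
    by rewrite leNgt yM.
  - by move=> t _; rewrite lee_fin cap_ge0.
  - apply/measurable_EFinP; apply: nonincreasing_measurable; last exact: level_nonincreasing.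
    exact: measurableU.
  rewrite [X in (_ + X)%E]integral0_eq ?adde0; last first.
    move=> t; rewrite /= in_itv/= andbT => Mt; rewrite level_high// => xi hxi.
    exact: lt_le_trans (xM _ hxi) Mt.
  have := integral_nonincreasing_increment (level x) (cut x) 0 M (level_nonincreasing x) (cutB_bounds x).
  rewrite add0r => ->; rewrite (cut_full x M%:R)// => xi hxi.
  exact/ltW/xM.
have neg : (\int[@lebesgue_measure R]_(t in `]-oo, 0%R[) (level x t - 1)%:E = (cut x 0)%:E)%E.
  have level1_ni : {homo (fun t => level x t - 1) : s t / s <= t >-> t <= s}.
    by move=> s t st; rewrite lerD2r level_nonincreasing.
  rewrite (@itv_bndbnd_setU _ _ _ (BLeft (- M%:R))) ?bnd_simp ?oppr_le0//.
  have mU : measurable (`]-oo, (- M%:R)%R[ `|` `[(- M%:R)%R, 0%R[ : set R) by exact: measurableU.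
  rewrite integral_setU//=; first last.
  - apply/disj_setPS => y [/=]; rewrite 2!in_itv/= => yM /andP[].
    by rewrite leNgt yM.
  - by apply/measurable_EFinP; exact: nonincreasing_measurable.
  rewrite integral0_eq ?add0e; last first.
    move=> t; rewrite /= in_itv/= => Mt; rewrite level_low ?subrr// => xi hxi.
    exact: le_trans (ltW Mt) (Mx _ hxi).
  (* The antiderivative of [level x - 1] is [cut x t - t], which vanishes at [- M]. The remaining
     [cut x 0] cancels against the positive half. *)
  have := integral_nonincreasing_increment (fun t => level x t - 1) (fun t => cut x t - t)
    (- M%:R) M level1_ni.
  rewrite addNr => ->.
    by rewrite (cut_low x (- M%:R))// subrr !subr0.
  move=> t m; have /andP[] := cutB_bounds x t m; set h := _^-1.
  by move=> ? ?; apply/andP; split; lra.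
by rewrite /choquet -/ext [X in (X + _)%E]pos neg -EFinD subrK.
Qed.
End riesz_spaces.

Theorem theorem2p3 (R : realType) (X : lmodType R) (le : X -> X -> Prop)
    (join meet : X -> X -> X) (e : X) (N : set X) (V : X -> R) :
  riesz_space le join meet -> archimedean le -> strong_unit le e ->
  order_ideal le join N -> N <> setT -> uniformly_closed le join N ->
  normalized_fun e V -> monotone_fun le V -> unit_additive e V ->
  unit_modular join meet e V -> N_invariant N V ->
  exists nu : set (X -> R) -> R,
    normalized_capacity (ext_N le join e N) nu /\
    forall x : X, (V x)%:E = choquet (ext_N le join e N) nu (fun xi => xi x).
Proof.
move=> hX _ he idN NT Ncl Vnorm Vmono Vadd Vmod Vinv.
have Ne : ~ N e by move=> /(ideal_unit le join meet hX e he N idN).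
exists (cap join e N V); split.
  exact: (cap_normalized le join meet).
exact: (V_choquet le join meet).
Qed.
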